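(* Let $(R_n)$ be a sequence of (not necessarily unital) $QB$-rings, and let $\varphi_n:R_n\to R_{n+1}$ be ring homomorphisms such that $\varphi_n(R_n)$ is primely embedded in $R_{n+1}$ for every $n$. Then the direct limit $R=\varinjlim R_n$ is a $QB$-ring.
   Context: Rings are associative and not necessarily unital, and homomorphisms need not be unital. For a ring $S$ let $\widetilde S=S\oplus\mathbb Z$ be its canonical unitization. For $s,t\in S$, say $s\perp t$ in $S$ if $s\widetilde S t=0$ and $t\widetilde S s=0$. An element $x\in S$ is quasi-adversible, $x\in S_q^\circ$, if there are $b,c\in S$ with $(x+b-xb)\perp(x+c-cx)$. $\operatorname{cl}^\circ(S_q^\circ)$ is the set of $a\in S$ such that whenever $xa-x-a+b=0$ for some $x,b\in S$, there is $y\in S$ with $a-yb\in S_q^\circ$. $S$ is a $QB$-ring if $\operatorname{cl}^\circ(S_q^\circ)=S$. (For unital $S$ this is equivalent to: whenever $xa+b=1$ in $S$ there is $y\in S$ such that $u=a+yb$ is quasi-invertible, i.e. there are $c,d\in S$ with $(1-uc)\perp(1-du)$.) A subring $S$ of a ring $R$ is primely embedded in $R$ if for any two idempotents $p,q\in S$, $p\perp q$ in $S$ implies $p\perp q$ in $R$. *)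

(* Defs.v *)
From HB Require Import structures.
From mathcomp Require Import all_boot all_order all_algebra.
From mathcomp Require Import boolp classical_sets.

Set Implicit Arguments.
Unset Strict Implicit.
Unset Printing Implicit Defensive.

Import GRing.Theory.

Local Open Scope ring_scope.

(* Not necessarily unital, possibly zero, associative rings. The ring types of
   ssralg all have a unit, so the product is the one of semigroupType; it is
   written (x * y)%g, since (x * y)%R is reserved to unital (semi)rings. *)
HB.mixin Record Zmodule_Semigroup_isRng R of GRing.Zmodule R & Semigroup R := {
  rmulDl : forall x y z : R, ((x + y) * z)%g = (x * z)%g + (y * z)%g;
  rmulDr : forall x y z : R, (x * (y + z))%g = (x * y)%g + (x * z)%g
}.

#[short(type="rngType")]
HB.structure Definition Rng :=
  {R of GRing.Zmodule R & Semigroup R & Zmodule_Semigroup_isRng R}.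

HB.structure Definition RngMorphism (R S : rngType) :=
  {f of @isMultiplicative R S f & @GRing.isNmodMorphism R S f}.

Notation "{ 'rng_morphism' R -> S }" := (RngMorphism.type R%type S%type)
  (at level 0, R at level 98, S at level 99,
   format "{ 'rng_morphism'  R  ->  S }") : type_scope.

#[short(type="subRngType")]
HB.structure Definition SubRng (R : rngType) (P : pred R) :=
  {S of GRing.SubZmodule R P S & SubSemigroup R P S & Rng S}.

Section RngTheory.
Variable R : rngType.
Implicit Types x y : R.

Lemma rmul0x x : (0 * x)%g = 0 :> R.
Proof. by apply: (addIr (0 * x)%g); rewrite -rmulDl !add0r. Qed.

Lemma rmulx0 x : (x * 0)%g = 0 :> R.
Proof. by apply: (addIr (x * 0)%g); rewrite -rmulDr !add0r. Qed.

Lemma rmulNx x y : (- x * y)%g = - (x * y)%g :> R.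
Proof. by apply/eqP; rewrite -addr_eq0 -rmulDl addNr rmul0x. Qed.

Lemma rmulxN x y : (x * - y)%g = - (x * y)%g :> R.
Proof. by apply/eqP; rewrite -addr_eq0 -rmulDr addNr rmulx0. Qed.

Lemma rmulnx x y n : ((x *+ n) * y)%g = (x * y)%g *+ n :> R.
Proof. by elim: n => [|n IH]; rewrite ?mulr0n ?rmul0x// !mulrS rmulDl IH. Qed.

Lemma rmulxn x y n : (x * (y *+ n))%g = (x * y)%g *+ n :> R.
Proof. by elim: n => [|n IH]; rewrite ?mulr0n ?rmulx0// !mulrS rmulDr IH. Qed.

Lemma rmulzx x y (n : int) : ((x *~ n) * y)%g = (x * y)%g *~ n :> R.
Proof.
by case: n => n; rewrite ?NegzE ?mulrNz ?rmulNx -!pmulrn rmulnx.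
Qed.

Lemma rmulxz x y (n : int) : (x * (y *~ n))%g = (x * y)%g *~ n :> R.
Proof.
by case: n => n; rewrite ?NegzE ?mulrNz ?rmulxN -!pmulrn rmulxn.
Qed.

End RngTheory.

Definition unitization (S : rngType) : Type := (S * int)%type.

Section Unitization.
Variable S : rngType.

HB.instance Definition _ := GRing.Zmodule.copy (unitization S) (S * int)%type.

Definition unitization_one : unitization S := (0, 1).

Definition unitization_mul (u v : unitization S) : unitization S :=
  ((u.1 * v.1)%g + u.1 *~ v.2 + v.1 *~ u.2, u.2 * v.2).

Fact unitization_mulA : associative unitization_mul.
Proof.
move=> [x m] [y n] [z p]; rewrite /unitization_mul /=; congr pair; last first.
  by rewrite mulrA.
rewrite !rmulDl !rmulDr !mulrzDl !rmulzx !rmulxz !mulgA -!mulrzA.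
rewrite [p * m]mulrC [n * m]mulrC -!addrA; congr (_ + _).
rewrite [LHS]addrCA; congr (_ + _).
rewrite [RHS]addrCA; congr (_ + _).
by rewrite [RHS]addrCA.
Qed.

Fact unitization_mul1 : left_id unitization_one unitization_mul.
Proof.
by move=> [x m]; rewrite /unitization_mul /= rmul0x mul0rz mulr1z !add0r mul1r.
Qed.

Fact unitization_mulr1 : right_id unitization_one unitization_mul.
Proof.
by move=> [x m]; rewrite /unitization_mul /= rmulx0 mul0rz mulr1z add0r addr0 mulr1.
Qed.

Fact unitization_mulDl : left_distributive unitization_mul +%R.
Proof.
move=> [x m] [y n] [z p]; rewrite /unitization_mul /=; congr pair; last first.
  by rewrite mulrDl.
by rewrite rmulDl mulrzDl mulrzDr [RHS]addrACA; congr (_ + _); rewrite addrACA.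
Qed.

Fact unitization_mulDr : right_distributive unitization_mul +%R.
Proof.
move=> [x m] [y n] [z p]; rewrite /unitization_mul /=; congr pair; last first.
  by rewrite mulrDr.
by rewrite rmulDr mulrzDl mulrzDr [RHS]addrACA; congr (_ + _); rewrite addrACA.
Qed.

Fact unitization_one_neq0 : unitization_one != 0.
Proof. by apply/eqP => -[]. Qed.

HB.instance Definition _ := GRing.Zmodule_isNzRing.Build (unitization S)
  unitization_mulA unitization_mul1 unitization_mulr1
  unitization_mulDl unitization_mulDr unitization_one_neq0.

Definition to_unitization (s : S) : unitization S := (s, 0).

End Unitization.

Section QBRings.
Variable S : rngType.

Definition perp (s t : S) : Prop :=
  (forall u : unitization S, to_unitization s * u * to_unitization t = 0) /\
  (forall u : unitization S, to_unitization t * u * to_unitization s = 0).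

Definition quasi_adversible (x : S) : Prop :=
  exists b c : S, perp (x + b - (x * b)%g) (x + c - (c * x)%g).

Definition cl_quasi_adversible (a : S) : Prop :=
  forall x b : S, (x * a)%g - x - a + b = 0 ->
    exists y : S, quasi_adversible (a - (y * b)%g).

Definition QB_ring : Prop := forall a : S, cl_quasi_adversible a.

Definition idempotent (p : S) : Prop := (p * p)%g = p.

End QBRings.

(* Orthogonality in the subring S only tests against the unitization of S. *)
Definition primely_embedded (R : rngType) (P : pred R) (S : subRngType P) :
    Prop :=
  forall p q : S, idempotent p -> idempotent q ->
    perp p q -> perp (val p) (val q).

Definition rng_image (R S : rngType) (f : {rng_morphism R -> S}) : Type :=
  {y : S | y \in range f}.

Section RngImage.
Variables (R S : rngType) (f : {rng_morphism R -> S}).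

HB.instance Definition _ := SubChoice.on (rng_image f).

Fact range_zmod_closed : zmod_closed (fun y => y \in range f).
Proof.
split; first by apply/mem_set; exists 0; rewrite ?raddf0.
move=> _ _ /set_mem[x _ <-] /set_mem[y _ <-].
by apply/mem_set; exists (x - y); rewrite ?raddfB.
Qed.

Fact range_mulg_closed : mulg_closed (fun y => y \in range f).
Proof.
move=> _ _ /set_mem[x _ <-] /set_mem[y _ <-].
by apply/mem_set; exists (x * y)%g; rewrite ?gmulfM.
Qed.

HB.instance Definition _ :=
  GRing.SubChoice_isSubZmodule.Build S _ (rng_image f) range_zmod_closed.
HB.instance Definition _ :=
  SubChoice_isSubSemigroup.Build S _ (rng_image f) range_mulg_closed.

Fact rng_image_mulDl (x y z : rng_image f) :
  ((x + y) * z)%g = (x * z)%g + (y * z)%g.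
Proof. by apply: val_inj; rewrite !(gmulfM, raddfD) rmulDl. Qed.

Fact rng_image_mulDr (x y z : rng_image f) :
  (x * (y + z))%g = (x * y)%g + (x * z)%g.
Proof. by apply: val_inj; rewrite !(gmulfM, raddfD) rmulDr. Qed.

HB.instance Definition _ := Zmodule_Semigroup_isRng.Build (rng_image f)
  rng_image_mulDl rng_image_mulDr.

End RngImage.

Section DirectLimit.
Variables (R : nat -> rngType) (phi : forall n, {rng_morphism R n -> R n.+1}).

Definition cocone (L : rngType) (psi : forall n, {rng_morphism R n -> L}) :
    Prop :=
  forall n (x : R n), psi n.+1 (phi n x) = psi n x.

Definition is_direct_limit (L : rngType)
    (psi : forall n, {rng_morphism R n -> L}) : Prop :=
  cocone psi /\
  forall (T : rngType) (g : forall n, {rng_morphism R n -> T}), cocone g ->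
    exists2 h : {rng_morphism L -> T},
      (forall n, h \o psi n =1 g n) &
      (forall h' : {rng_morphism L -> T},
        (forall n, h' \o psi n =1 g n) -> h' =1 h).

End DirectLimit.

(* Main.v *)
(* Write circ x y = x + y - xy, so that 1 - circ x y = (1 - x)(1 - y) in the
   unitization. If x is quasi-adversible, a von Neumann regular quasi-inverse
   of 1 - x gives y such that circ x y and circ y x are orthogonal idempotents.
   Primeness, which only concerns idempotents, thus carries quasi-adversibility
   of x along all the maps phi, and orthogonality in every later stage gives
   orthogonality in the limit. Any relation xa - x - a + b = 0 in the limit
   already holds in some R m, where the QB-property provides the element y
   required in the limit. That every element of the limit comes from a stage,
   and that an element of a stage that vanishes in the limit vanishes at a
   later stage, follows from the universal property tested against the union
   of the images of the psi n and against the ring of germs at infinity of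
   sequences in the product of the R n, respectively. *)
Require Import Defs.
From HB Require Import structures.
From mathcomp Require Import all_boot all_order all_algebra.
From mathcomp Require Import boolp classical_sets.

Set Implicit Arguments.
Unset Strict Implicit.
Unset Printing Implicit Defensive.

Import GRing.Theory.
Local Open Scope ring_scope.
Local Open Scope quotient_scope.

(* Redeclaring known multiplicative instances lets HB join them with the
   additive ones into the later structure RngMorphism. *)
HB.instance Definition _ (R : rngType) :=
  isMultiplicative.Build R R idfun (fun _ _ => erefl).
HB.instance Definition _ (R S T : rngType) (f : {rng_morphism S -> T})
    (g : {rng_morphism R -> S}) :=
  isMultiplicative.Build R T (f \o g) (comp_gmulfM f g).

(** * Orthogonality and the circle operation in the unitization *)

Section Perp.
Variable S : rngType.
Implicit Types s t x y : S.

Lemma to_unitizationD x y :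
  to_unitization (x + y) = to_unitization x + to_unitization y.
Proof. by congr pair. Qed.

Lemma to_unitizationN x : to_unitization (- x) = - to_unitization x.
Proof. by congr pair. Qed.

Lemma to_unitizationM x y :
  to_unitization (x * y)%g = to_unitization x * to_unitization y.
Proof. by congr pair; rewrite /= !mulr0z !addr0. Qed.

Lemma to_unitization_inj : injective (@to_unitization S).
Proof. by move=> x y []. Qed.

Lemma to_unitization_mulz x (n : int) :
  to_unitization x * ((0, n) : unitization S) = to_unitization (x *~ n).
Proof. by congr pair; rewrite /= ?rmulx0 ?mul0rz ?add0r ?addr0 ?mul0r. Qed.

Lemma unitizationE (u : unitization S) :
  u = to_unitization u.1 + ((0, u.2) : unitization S).
Proof. by case: u => x n; congr pair; rewrite /= ?addr0 ?add0r. Qed.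

Lemma sandwichE s t (u : unitization S) :
  to_unitization s * u * to_unitization t =
  to_unitization ((s * u.1 * t)%g + (s * t)%g *~ u.2).
Proof.
rewrite [in LHS](unitizationE u) mulrDr mulrDl to_unitization_mulz.
by rewrite -!to_unitizationM -to_unitizationD rmulzx.
Qed.

(** The elements [(0, 1)] and [(x, 0)] generate the unitization additively, so testing on them
    suffices. *)
Lemma perpP s t :
  perp s t <-> [/\ (s * t)%g = 0, (t * s)%g = 0,
    forall x, (s * x * t)%g = 0 & forall x, (t * x * s)%g = 0].
Proof.
split=> [[st ts]|[st ts sxt txs]].
  split=> [||x|x].
  - have:= st (0, 1); rewrite sandwichE => /to_unitization_inj.
    by rewrite rmulx0 rmul0x add0r.
  - have:= ts (0, 1); rewrite sandwichE => /to_unitization_inj.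
    by rewrite rmulx0 rmul0x add0r.
  - have:= st (x, 0); rewrite sandwichE => /to_unitization_inj.
    by rewrite addr0.
  - have:= ts (x, 0); rewrite sandwichE => /to_unitization_inj.
    by rewrite addr0.
by split=> u; rewrite sandwichE ?sxt ?txs ?st ?ts mul0rz addr0.
Qed.

Definition circ x y : S := x + y - (x * y)%g.

Lemma to_unitization_circ x y :
  to_unitization (circ x y) =
  1 - (1 - to_unitization x) * (1 - to_unitization y).
Proof.
rewrite /circ !to_unitizationD to_unitizationN to_unitizationM.
by rewrite mulrBr mulr1 mulrBl mul1r !opprD !opprK !addrA subrr add0r.
Qed.

End Perp.

(* The last factor of 1 - v * u, and the first one of 1 - u * v, are the
   factors of the hypothesis: orthogonality survives the change to v. *)
Lemma one_sub_quasi_inv (A : nzRingType) (u c d : A) :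
    (1 - u * c) * u * (1 - d * u) = 0 ->
  let v := c + d - c * u * d in
  [/\ u * v * u = u, 1 - u * v = (1 - u * c) * (1 - u * d)
    & 1 - v * u = (1 - c * u) * (1 - d * u)].
Proof.
move=> ucu v.
have uvE : 1 - u * v = (1 - u * c) * (1 - u * d).
  rewrite [RHS]mulrBr mulr1 [X in _ = _ - X]mulrBl mul1r /v mulrBr mulrDr.
  by rewrite -[in LHS]addrA opprD addrA !mulrA.
have vuE : 1 - v * u = (1 - c * u) * (1 - d * u).
  rewrite [RHS]mulrBr mulr1 [X in _ = _ - X]mulrBl mul1r /v mulrBl mulrDl.
  by rewrite -[in LHS]addrA opprD addrA !mulrA.
split=> //; apply/esym/eqP; rewrite -subr_eq0.
have -> : u - u * v * u = (1 - u * v) * u by rewrite mulrBl mul1r.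
(* Moving [u] across the second factor turns [(1 - u * v) * u] into the product that vanishes by
   [ucu]. *)
have ud : (1 - u * d) * u = u * (1 - d * u).
  by rewrite mulrBl mulrBr mul1r mulr1 mulrA.
by rewrite uvE -mulrA ud mulrA ucu.
Qed.

Lemma quasi_adversible_idem (S : rngType) (x : S) : quasi_adversible x ->
  exists y, [/\ Defs.idempotent (circ x y), Defs.idempotent (circ y x) &
    perp (circ x y) (circ y x)].
Proof.
move=> [b [c [xbc cxb]]].
pose i := @to_unitization S.
pose u := 1 - i x; pose b' := 1 - i b; pose c' := 1 - i c.
have iP z w : i (circ z w) = 1 - (1 - i z) * (1 - i w).
  exact: to_unitization_circ.
have xb : i (x + b - (x * b)%g) = 1 - u * b' by rewrite iP.
have cx : i (x + c - (c * x)%g) = 1 - c' * u by rewrite [x + c]addrC iP.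
(* Regularity comes from testing the given orthogonality on [u] itself. *)
have [] := @one_sub_quasi_inv _ u b' c'; first by rewrite -xb -cx xbc.
set v := _ - _ => uvu uvE vuE.
(* This solves [v = 1 - i y]: [b' * u * c'] is [1 - i (circ (circ b x) c)], so the constant terms of
   [v] sum to 1. *)
pose y := b + c - circ (circ b x) c.
have vE : v = 1 - i y.
  rewrite /y /i to_unitizationD to_unitizationN to_unitizationD -!/i !iP.
  rewrite !subKr /v -/b' -/c' -/u opprB addrACA -opprD -addrA.
  by rewrite -addrA [X in 1 + X = _]addrAC.
have xyE : i (circ x y) = 1 - u * v by rewrite iP -vE.
have yxE : i (circ y x) = 1 - v * u by rewrite iP -vE.
clearbody v u b' c'; exists y; split.
- apply: (@to_unitization_inj S); rewrite to_unitizationM -/i xyE.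
  by rewrite mulrBr mulr1 mulrBl mul1r !mulrA uvu subrr subr0.
- apply: (@to_unitization_inj S); rewrite to_unitizationM -/i yxE.
  by rewrite mulrBr mulr1 mulrBl mul1r -mulrA [u * _]mulrA uvu subrr subr0.
(* After factoring, the outermost factors sandwich everything else in one order, and the innermost
   ones sandwich [w] in the other; each sandwich is zero by hypothesis. *)
- have reassoc (p q w r t : unitization S) :
    p * q * w * (r * t) = p * (q * w * r) * t by rewrite !mulrA.
  split=> w; rewrite -/i xyE yxE uvE vuE reassoc -xb -cx.
    exact: xbc.
  by rewrite cxb mulr0 mul0r.
Qed.

(** Elements of the image lift to [R], so the images of [p] and [q] are orthogonal inside the image
    of [f]; primeness extends this to [S]. *)
Lemma perp_morph (R S : rngType) (f : {rng_morphism R -> S}) (p q : R) :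
    primely_embedded (rng_image f) -> Defs.idempotent p -> Defs.idempotent q ->
  perp p q -> perp (f p) (f q).
Proof.
move=> f_prime pp qq /perpP[pq qp pxq qxp].
have inr z : f z \in range f by apply/mem_set; exists z.
pose im z : rng_image f := exist _ (f z) (inr z).
have imM y z : im (y * z)%g = (im y * im z)%g.
  by apply: val_inj; rewrite [LHS]/= [RHS]gmulfM /= gmulfM.
have im0 : im 0 = 0 by apply: val_inj; rewrite /= raddf0.
have im_surj (w : rng_image f) : exists z, w = im z.
  by case: w => w wf; have /set_mem[z _ fz] := wf; exists z; apply: val_inj.
apply: (f_prime (im p) (im q)); rewrite /Defs.idempotent -?imM ?pp ?qq //.
apply/perpP; split=> [||w|w]; rewrite -?imM ?pq ?qp ?im0 //.
  by have [z ->] := im_surj w; rewrite -!imM pxq im0.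
by have [z ->] := im_surj w; rewrite -!imM qxp im0.
Qed.

(** * Transition maps between arbitrary stages *)

Section Transition.
Variables (R : nat -> rngType) (phi : forall n, {rng_morphism R n -> R n.+1}).

(** Totality in both indices makes every transition map a ring morphism without a side condition on
    the indices. *)
Definition cast_or_zero n m (x : R n) : R m :=
  match @eqP nat n m with
  | ReflectT e => ecast k (R k) e x
  | ReflectF _ => 0
  end.

(* Junk value: trans m x = 0 for x : R n with m < n. *)
Fixpoint trans n m (x : R n) : R m :=
  match m return R m with
  | 0 => cast_or_zero 0 x
  | m'.+1 => if (n <= m')%N then phi m' (trans m' x) else cast_or_zero m'.+1 x
  end.

Lemma cast_or_zeroD n m : {morph @cast_or_zero n m : x y / x + y}.
Proof.
rewrite /cast_or_zero => x y; case: eqP => [e|_]; first by case: m / e.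
by rewrite addr0.
Qed.

Lemma cast_or_zeroM n m : {morph @cast_or_zero n m : x y / (x * y)%g}.
Proof.
rewrite /cast_or_zero => x y; case: eqP => [e|_]; first by case: m / e.
by rewrite rmulx0.
Qed.

Lemma cast_or_zero_id n (x : R n) : cast_or_zero n x = x.
Proof.
by rewrite /cast_or_zero; case: eqP => // e; rewrite (eq_axiomK e).
Qed.

Lemma trans_id n (x : R n) : trans n x = x.
Proof. by case: n x => [|n] x /=; rewrite ?ltnn cast_or_zero_id. Qed.

Lemma transS n m (x : R n) : (n <= m)%N -> trans m.+1 x = phi m (trans m x).
Proof. by move=> /= ->. Qed.

Lemma transD n m : {morph @trans n m : x y / x + y}.
Proof.
elim: m => [|m IH] x y; first exact: cast_or_zeroD.
by rewrite /=; case: leqP => _; rewrite ?IH ?raddfD ?cast_or_zeroD.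
Qed.

Lemma transM n m : {morph @trans n m : x y / (x * y)%g}.
Proof.
elim: m => [|m IH] x y; first exact: cast_or_zeroM.
by rewrite /=; case: leqP => _; rewrite ?IH ?gmulfM ?cast_or_zeroM.
Qed.

Lemma trans0 n m : @trans n m 0 = 0.
Proof. by apply: (addIr (@trans n m 0)); rewrite -transD !add0r. Qed.

HB.instance Definition _ n m := isMultiplicative.Build _ _ _ (@transM n m).
HB.instance Definition _ n m :=
  GRing.isNmodMorphism.Build _ _ _ (conj (@trans0 n m) (@transD n m)).

Lemma trans_phi n m (x : R n) : (n < m)%N -> trans m (phi n x) = trans m x.
Proof.
elim: m => // m IH; rewrite ltnS leq_eqVlt => /predU1P[<-|nm].
  by rewrite trans_id transS // trans_id.
by rewrite !transS ?IH // ltnW.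
Qed.

Lemma cocone_trans (L : rngType) (psi : forall n, {rng_morphism R n -> L})
    n m (x : R n) :
  cocone phi psi -> (n <= m)%N -> psi m (trans m x) = psi n x.
Proof.
move=> psi_cocone; elim: m => [|m IH].
  by rewrite leqn0 => /eqP n0; move: x; rewrite n0 => x; rewrite trans_id.
rewrite leq_eqVlt => /predU1P[n_eq|nm].
  by move: x {IH}; rewrite n_eq => x; rewrite trans_id.
by rewrite transS // psi_cocone IH.
Qed.

Lemma perp_trans n m (p q : R n) :
    (forall k, primely_embedded (rng_image (phi k))) -> (n <= m)%N ->
    Defs.idempotent p -> Defs.idempotent q -> perp p q ->
  perp (trans m p) (trans m q).
Proof.
move=> phi_prime + pp qq pq; elim: m => [|m IH].
  rewrite leqn0 => /eqP n0.
  by move: p q pp qq pq; rewrite n0 => *; rewrite !trans_id.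
rewrite leq_eqVlt => /predU1P[n_eq|nm].
  by move: p q pp qq pq {IH}; rewrite n_eq => *; rewrite !trans_id.
rewrite !transS //; apply: perp_morph; rewrite /Defs.idempotent //.
- by rewrite -gmulfM pp.
- by rewrite -gmulfM qq.
- exact: IH.
Qed.

End Transition.

(** * The ring of germs at infinity of sequences *)

Section Germs.
Variables (R : nat -> rngType) (phi : forall n, {rng_morphism R n -> R n.+1}).

Definition rng_seq : Type := forall n, R n.
HB.instance Definition _ := Choice.copy rng_seq (forall n, R n).
Implicit Types x y z : rng_seq.

Definition seq_zero : rng_seq := fun=> 0.
Definition seq_opp x : rng_seq := fun n => - x n.
Definition seq_add x y : rng_seq := fun n => x n + y n.
Definition seq_mul x y : rng_seq := fun n => (x n * y n)%g.

Fact seq_addA : associative seq_add.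
Proof.
by move=> x y z; apply: functional_extensionality_dep=> n; apply: addrA.
Qed.

Fact seq_addC : commutative seq_add.
Proof.
by move=> x y; apply: functional_extensionality_dep=> n; apply: addrC.
Qed.

Fact seq_add0 : left_id seq_zero seq_add.
Proof.
by move=> x; apply: functional_extensionality_dep=> n; apply: add0r.
Qed.

Fact seq_addN : left_inverse seq_zero seq_opp seq_add.
Proof.
by move=> x; apply: functional_extensionality_dep=> n; apply: addNr.
Qed.


HB.instance Definition _ :=
  GRing.isZmodule.Build rng_seq seq_addA seq_addC seq_add0 seq_addN.

Definition tail_zero : {pred rng_seq} :=
  [pred x : rng_seq | `[< exists m, forall n, (m <= n)%N -> x n = 0 >]].

Fact tail_zero_zmod_closed : zmod_closed tail_zero.
Proof.
split=> [|x y]; first by apply/asboolP; exists 0.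
move=> /asboolP[m xm] /asboolP[k yk]; apply/asboolP; exists (maxn m k) => n.
rewrite geq_max => /andP[mn kn].
by rewrite [LHS](_ : _ = x n - y n) // xm // yk // subr0.
Qed.

HB.instance Definition _ :=
  GRing.isZmodClosed.Build rng_seq tail_zero tail_zero_zmod_closed.

(** Only the additive quotient; the product is defined below through representatives. *)
Definition germ : Type := Quotient.quot tail_zero.
HB.instance Definition _ := GRing.Zmodule.on germ.
Definition to_germ : rng_seq -> germ := \pi_(Quotient.quot tail_zero).

Lemma germ_surj (g : germ) : exists x, to_germ x = g.
Proof. by exists (repr g); rewrite /to_germ reprK. Qed.

Lemma eq_germ x y :
  to_germ x = to_germ y <-> exists m, forall n, (m <= n)%N -> x n = y n.
Proof.
have tailE : (to_germ x == to_germ y) = (x - y \in tail_zero).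
  by rewrite Quotient.idealrBE.
split=> [/eqP|[m xy]].
  rewrite tailE => /asboolP[m xy]; exists m => n /xy /eqP.
  by rewrite [X in X == _](_ : _ = x n - y n) // subr_eq0 => /eqP.
apply/eqP; rewrite tailE; apply/asboolP; exists m => n /xy xyn.
by rewrite [LHS](_ : _ = x n - y n) // xyn subrr.
Qed.

Definition germ_mul (g h : germ) : germ := to_germ (seq_mul (repr g) (repr h)).

(** Each sequence agrees with the chosen representative of its germ from some index on, hence so do
    the products. *)
Lemma to_germM x y : to_germ (seq_mul x y) = germ_mul (to_germ x) (to_germ y).
Proof.
have [m xm] : exists m, forall n, (m <= n)%N -> x n = repr (to_germ x) n.
  by apply/eq_germ; rewrite /to_germ reprK.
have [k yk] : exists m, forall n, (m <= n)%N -> y n = repr (to_germ y) n.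
  by apply/eq_germ; rewrite /to_germ reprK.
apply/eq_germ; exists (maxn m k) => n; rewrite geq_max => /andP[mn kn].
by rewrite /seq_mul xm // yk.
Qed.

Lemma to_germD x y : to_germ (x + y) = to_germ x + to_germ y.
Proof. exact: raddfD. Qed.

Fact germ_mulA : associative germ_mul.
Proof.
move=> g h k.
have [[x <-] [y <-] [z <-]] := And3 (germ_surj g) (germ_surj h) (germ_surj k).
rewrite -!to_germM; congr to_germ.
by apply: functional_extensionality_dep=> n; apply: mulgA.
Qed.

HB.instance Definition _ := isSemigroup.Build germ germ_mulA.

Fact germ_mulDl (g h k : germ) : ((g + h) * k)%g = (g * k)%g + (h * k)%g.
Proof.
have [[x <-] [y <-] [z <-]] := And3 (germ_surj g) (germ_surj h) (germ_surj k).
rewrite -to_germD -[LHS]to_germM -[X in _ = X + _]to_germM.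
rewrite -[X in _ = _ + X]to_germM -to_germD; congr to_germ.
by apply: functional_extensionality_dep=> n; apply: rmulDl.
Qed.

Fact germ_mulDr (g h k : germ) : (g * (h + k))%g = (g * h)%g + (g * k)%g.
Proof.
have [[x <-] [y <-] [z <-]] := And3 (germ_surj g) (germ_surj h) (germ_surj k).
rewrite -to_germD -[LHS]to_germM -[X in _ = X + _]to_germM.
rewrite -[X in _ = _ + X]to_germM -to_germD; congr to_germ.
by apply: functional_extensionality_dep=> n; apply: rmulDr.
Qed.

HB.instance Definition _ :=
  Zmodule_Semigroup_isRng.Build germ germ_mulDl germ_mulDr.

Definition trans_seq n (x : R n) : rng_seq := fun m => trans phi m x.
Definition trans_germ n (x : R n) : germ := to_germ (trans_seq x).

Fact trans_germ_nmod n : nmod_morphism (@trans_germ n).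
Proof.
split=> [|x y].
  rewrite -[RHS](raddf0 \pi_(Quotient.quot tail_zero)); congr to_germ.
  by apply: functional_extensionality_dep=> m; apply: raddf0.
rewrite -to_germD; congr to_germ.
by apply: functional_extensionality_dep=> m; apply: raddfD.
Qed.

Fact trans_germM n : {morph @trans_germ n : x y / (x * y)%g}.
Proof.
move=> x y; rewrite -[RHS]to_germM; congr to_germ.
by apply: functional_extensionality_dep=> m; apply: transM.
Qed.

HB.instance Definition _ n :=
  GRing.isNmodMorphism.Build _ _ _ (@trans_germ_nmod n).
HB.instance Definition _ n := isMultiplicative.Build _ _ _ (@trans_germM n).

Lemma trans_germ_cocone : cocone phi (fun n => @trans_germ n).
Proof.
(* At index [n] the sequence of [phi n x] still has the junk value 0, so agreement is claimed only
   from [n.+1] on. *)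
move=> n x; apply/eq_germ; exists n.+1 => m nm; exact: trans_phi.
Qed.

End Germs.

(** * Elements and orthogonality in the direct limit *)

Section LimitElements.
Variables (R : nat -> rngType) (phi : forall n, {rng_morphism R n -> R n.+1}).
Variables (L : rngType) (psi : forall n, {rng_morphism R n -> L}).
Hypothesis L_lim : is_direct_limit phi psi.

Lemma limit_eq0 n (x : R n) :
  psi n x = 0 -> exists2 m, (n <= m)%N & trans phi m x = 0.
Proof.
move=> psix; have [_ /(_ _ _ (trans_germ_cocone phi))[h hpsi _]] := L_lim.
have : trans_germ phi x = trans_germ phi (0 : R n).
  by rewrite -!hpsi /= psix !raddf0.
(* The index [m] may lie below [n], where vanishing says nothing about [x]. *)
move=> /eq_germ[m xm]; exists (maxn n m); rewrite ?leq_maxl //.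
by have := xm (maxn n m) (leq_maxr _ _); rewrite /trans_seq trans0.
Qed.

Definition limit_range : {pred L} :=
  [pred y | `[< exists n x, psi n x = y >]].

Lemma limit_range_common y z : y \in limit_range -> z \in limit_range ->
  exists n (x x' : R n), psi n x = y /\ psi n x' = z.
Proof.
move=> /asboolP[n [x <-]] /asboolP[m [x' <-]].
exists (maxn n m), (trans phi _ x), (trans phi _ x').
by rewrite !(cocone_trans _ (proj1 L_lim)) ?leq_maxl ?leq_maxr.
Qed.

Fact limit_range_zmod_closed : zmod_closed limit_range.
Proof.
split=> [|y z]; first by apply/asboolP; exists 0, 0; rewrite raddf0.
move=> /limit_range_common/[apply] -[n [x [x' [<- <-]]]].
by apply/asboolP; exists n, (x - x'); rewrite raddfB.
Qed.

Fact limit_range_mulg_closed : mulg_closed limit_range.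
Proof.
move=> y z /limit_range_common/[apply] -[n [x [x' [<- <-]]]].
by apply/asboolP; exists n, (x * x')%g; rewrite gmulfM.
Qed.

Definition limit_image : Type := {y : L | limit_range y}.
HB.instance Definition _ := SubChoice.on limit_image.
HB.instance Definition _ := GRing.SubChoice_isSubZmodule.Build L _ limit_image
  limit_range_zmod_closed.
HB.instance Definition _ := SubChoice_isSubSemigroup.Build L _ limit_image
  limit_range_mulg_closed.

Fact limit_image_mulDl (x y z : limit_image) :
  ((x + y) * z)%g = (x * z)%g + (y * z)%g.
Proof. by apply: val_inj; rewrite !(gmulfM, raddfD) rmulDl. Qed.

Fact limit_image_mulDr (x y z : limit_image) :
  (x * (y + z))%g = (x * y)%g + (x * z)%g.
Proof. by apply: val_inj; rewrite !(gmulfM, raddfD) rmulDr. Qed.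

HB.instance Definition _ := Zmodule_Semigroup_isRng.Build limit_image
  limit_image_mulDl limit_image_mulDr.
HB.instance Definition _ :=
  isMultiplicative.Build limit_image L val (@valM _ _ limit_image).

Fact psi_in_range n (x : R n) : limit_range (psi n x).
Proof. by apply/asboolP; exists n, x. Qed.

Definition to_limit_image n (x : R n) : limit_image :=
  exist _ (psi n x) (psi_in_range x).

Fact to_limit_image_nmod n : nmod_morphism (@to_limit_image n).
Proof.
by split=> [|x y]; apply: val_inj; rewrite [LHS]/= ?raddf0 ?raddfD.
Qed.

Fact to_limit_imageM n : {morph @to_limit_image n : x y / (x * y)%g}.
Proof.
by move=> x y; apply: val_inj; rewrite [LHS]/= [RHS]gmulfM /= gmulfM.
Qed.

HB.instance Definition _ n :=
  GRing.isNmodMorphism.Build _ _ _ (@to_limit_image_nmod n).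
HB.instance Definition _ n :=
  isMultiplicative.Build _ _ _ (@to_limit_imageM n).

(** The universal property gives [h] from [L] to the union of the images. Both [val \o h] and the
    identity are compatible with [psi], so they agree by uniqueness. *)
Lemma limit_surj y : exists n x, psi n x = y.
Proof.
have [psi_cocone univ] := L_lim.
have [|h hpsi _] := univ _ (fun n => @to_limit_image n).
  by move=> n x; apply: val_inj; apply: psi_cocone.
have [k _ k_uniq] := univ _ _ psi_cocone.
have kE := k_uniq (@idfun L) (fun n => frefl _).
have khE := k_uniq (val \o h : {rng_morphism L -> L}).
have hy : val (h y) = y.
  rewrite [RHS](kE y) -khE // => n x /=.
  by have /= -> := hpsi n x.
by have /asboolP := valP (h y); rewrite hy.
Qed.

Lemma perp_limit n (p q : R n) :
    (forall k, primely_embedded (rng_image (phi k))) ->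
    Defs.idempotent p -> Defs.idempotent q -> perp p q ->
  perp (psi n p) (psi n q).
Proof.
move=> phi_prime pp qq pq; have psiE := cocone_trans _ (proj1 L_lim).
have /perpP[pq0 qp0 _ _] := pq.
have sandwich y :
    (psi n p * y * psi n q)%g = 0 /\ (psi n q * y * psi n p)%g = 0.
  (* The sandwich is computed at a stage containing both [z] and the idempotents. *)
  have [m [z <-]] := limit_surj y.
  rewrite -(psiE _ (maxn n m) p) ?leq_maxl //.
  rewrite -(psiE _ (maxn n m) q) ?leq_maxl //.
  rewrite -(psiE _ (maxn n m) z) ?leq_maxr // -!gmulfM.
  have /perpP[_ _ pzq qzp] := perp_trans phi_prime (leq_maxl n m) pp qq pq.
  by rewrite pzq qzp /= raddf0.
apply/perpP; split=> [||y|y]; try by case: (sandwich y).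
  by rewrite -gmulfM pq0 /= raddf0.
by rewrite -gmulfM qp0 /= raddf0.
Qed.

Lemma quasi_adversible_limit n (x : R n) :
    (forall k, primely_embedded (rng_image (phi k))) ->
  quasi_adversible x -> quasi_adversible (psi n x).
Proof.
move=> phi_prime /quasi_adversible_idem[y [xy yx xy_perp]].
(* A single element serves on both sides, since [y] came from a two-sided quasi-inverse. *)
exists (psi n y), (psi n y).
have := perp_limit phi_prime xy yx xy_perp.
by rewrite /circ !raddfB !raddfD !gmulfM [psi n y + _]addrC.
Qed.

End LimitElements.

(** * Descent of the relation to a stage and return to the limit *)

Theorem proposition6p8
  (R : nat -> rngType)
  (phi : forall n : nat, {rng_morphism R n -> R n.+1})
  (R_QB : forall n : nat, QB_ring (R n))
  (phi_prime : forall n : nat, primely_embedded (rng_image (phi n)))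
  (L : rngType) (psi : forall n : nat, {rng_morphism R n -> L})
  (L_lim : is_direct_limit phi psi) :
  QB_ring L.
Proof.
move=> a x b rel.
have [na [a0 a0E]] := limit_surj L_lim a.
have [nx [x0 x0E]] := limit_surj L_lim x.
have [nb [b0 b0E]] := limit_surj L_lim b.
pose n := maxn na (maxn nx nb).
have psiE k (z : R k) m : (k <= m)%N -> psi m (trans phi m z) = psi k z.
  exact: cocone_trans (proj1 L_lim).
have na_le : (na <= n)%N by rewrite leq_maxl.
have nx_le : (nx <= n)%N by rewrite !leq_max leqnn orbT.
have nb_le : (nb <= n)%N by rewrite !leq_max leqnn !orbT.
pose a1 := trans phi n a0; pose x1 := trans phi n x0; pose b1 := trans phi n b0.
(* At the common stage [n] the relation need only hold after applying [psi n]; it becomes exact at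
   some later stage [m]. *)
have [|m nm] := @limit_eq0 _ _ _ _ L_lim n ((x1 * a1)%g - x1 - a1 + b1).
  by rewrite raddfD !raddfB gmulfM /a1 /x1 /b1 /= !psiE // a0E x0E b0E.
rewrite raddfD !raddfB gmulfM /= => /(R_QB m)[y].
move=> /(quasi_adversible_limit L_lim phi_prime).
rewrite raddfB gmulfM /a1 /b1 /= !psiE // a0E b0E; by exists (psi m y).
Qed.
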